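(* Let $t$ be a positive integer. The class of $K_{1,t}$-free graphs is polynomially $\chi_s$-bounded. Precisely, the $K_{1,t}$-free graphs $G$ satisfy \[\chi_s(G)=O\bigl(\omega(G)^{\frac{3(t-1)}{2}}\bigr),\] i.e. there is a constant $c_t$ depending only on $t$ such that every (non-empty) $K_{1,t}$-free graph $G$ satisfies $\chi_s(G)\leq c_t\,\omega(G)^{3(t-1)/2}$.
   Context: All graphs are finite, simple and undirected. A graph is $K_{1,t}$-free if it does not contain the star $K_{1,t}$ as an induced subgraph. The star chromatic number $\chi_s(G)$ is the minimum number of colors in a proper coloring of $G$ such that the union of any two color classes induces a star forest. $\omega(G)$ is the clique number of $G$. A hereditary class is polynomially $\chi_s$-bounded if $\chi_s(G)\le f(\omega(G))$ for all $G$ in the class, for some polynomially bounded function $f$. *)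

(* Defs.v *)
From HB Require Import structures.
From mathcomp Require Import all_boot all_order all_algebra.
From mathcomp Require Import boolp reals exp.

Set Implicit Arguments.
Unset Strict Implicit.
Unset Printing Implicit Defensive.

Import Order.TTheory GRing.Theory Num.Theory.

Record sgraph := SGraph {
  vertex :> finType;
  adj : rel vertex;
  adj_sym : symmetric adj;
  adj_irrefl : irreflexive adj }.

Arguments adj {s}.

Section InducedSubgraph.
Variables (G : sgraph) (S : {set G}).

Definition induced_adj : rel {x : G | x \in S} :=
  [rel x y | adj (val x) (val y)].

Lemma induced_adj_sym : symmetric induced_adj.
Proof. by move=> x y; apply: adj_sym. Qed.

Lemma induced_adj_irrefl : irreflexive induced_adj.
Proof. by move=> x; apply: adj_irrefl. Qed.

Definition induced : sgraph := SGraph induced_adj_sym induced_adj_irrefl.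
End InducedSubgraph.

Definition embedding (G H : sgraph) (f : G -> H) : Prop :=
  injective f /\ forall x y, adj (f x) (f y) = adj x y.

Definition isomorphic (G H : sgraph) : Prop :=
  exists2 f : G -> H, bijective f & embedding f.

(* Up to isomorphism: G is isomorphic to [induced S] for some S : {set H}. *)
Definition induced_subgraph (G H : sgraph) : Prop :=
  exists f : G -> H, embedding f.

Section Star.
Variable n : nat.

(* The centre of K_{1,n} is None, its leaves are the Some i. *)
Definition star_adj : rel (option 'I_n) := [rel x y | isSome x != isSome y].

Lemma star_adj_sym : symmetric star_adj.
Proof. by move=> x y; rewrite /star_adj /= eq_sym. Qed.

Lemma star_adj_irrefl : irreflexive star_adj.
Proof. by move=> x; rewrite /star_adj /= eqxx. Qed.

Definition star : sgraph := SGraph star_adj_sym star_adj_irrefl.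
End Star.

Definition star_free (t : nat) (G : sgraph) : Prop :=
  ~ induced_subgraph (star t) G.

Definition component (G : sgraph) (x : G) : {set G} :=
  [set y | connect adj x y].

(* An isolated vertex is the star K_{1,0}. *)
Definition star_forest (G : sgraph) : Prop :=
  forall x : G, exists n : nat, isomorphic (induced (component x)) (star n).

Definition proper_coloring (G : sgraph) (k : nat) (c : G -> 'I_k) : Prop :=
  forall x y : G, adj x y -> c x != c y.

Definition star_coloring (G : sgraph) (k : nat) (c : G -> 'I_k) : Prop :=
  proper_coloring c /\
  forall i j : 'I_k, i != j ->
    star_forest (induced [set x | (c x == i) || (c x == j)]).

Definition star_colorable (G : sgraph) (k : nat) : Prop :=
  exists c : G -> 'I_k, star_coloring c.

Lemma isomorphic_star_le2 (G : sgraph) (x : G) :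
  #|G| <= 2 -> (forall y, y != x -> adj x y) -> exists n, isomorphic G (star n).
Proof.
move=> G2 xadj; exists #|G|.-1.
have cardC : #|[set~ x]| = #|G|.-1 by rewrite cardsC1.
pose f (y : G) : star #|G|.-1 :=
  if y == x then None else [pick i : 'I_#|G|.-1].
have fE y : isSome (f y) = (y != x).
  rewrite /f; case: eqVneq => //= yx; case: pickP => // no.
  have : 0 < #|G|.-1 by rewrite -cardC; apply/card_gt0P; exists y; rewrite !inE.
  by move=> n0; have := no (Ordinal n0).
have small y z : y != x -> z != x -> y = z.
  move=> yx zx; have : #|[set~ x]| <= 1 by rewrite cardC; case: #|G| G2 => [|[|[]]].
  by move/card_le1_eqP; apply; rewrite !inE.
have finj : injective f.
  move=> y z e; have := fE z; rewrite -e fE.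
  case: (eqVneq y x) => [->|yx]; case: (eqVneq z x) => [->|zx] // _.
  exact: small.
exists f.
  apply: inj_card_bij => //; rewrite card_option card_ord prednK //.
  by apply/card_gt0P; exists x.
split=> // y z; transitivity (isSome (f y) != isSome (f z)); [by [] | rewrite !fE].
case: (eqVneq y x) => [->|yx]; case: (eqVneq z x) => [->|zx] /=.
- by rewrite adj_irrefl.
- by rewrite xadj.
- by rewrite adj_sym xadj.
- by rewrite (small _ _ yx zx) adj_irrefl.
Qed.

Lemma star_colorable_card (G : sgraph) : star_colorable G #|G|.
Proof.
exists enum_rank; split=> [x y xy|i j ij].
  apply: contraTneq xy => /enum_rank_inj ->; by rewrite adj_irrefl.
set H := induced _ => x.
have H2 : #|H| <= 2.
  rewrite card_sig; apply: leq_trans (_ : #|[set enum_val i; enum_val j]| <= 2).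
    apply/subset_leq_card/subsetP => z; rewrite !inE.
    by case/orP=> /eqP <-; rewrite enum_rankK eqxx ?orbT.
  by rewrite cards2; case: (_ != _).
have xC : x \in component x by rewrite inE connect0.
pose x' : induced (component x) := exist _ x xC.
have C2 : #|induced (component x)| <= 2.
  by rewrite card_sig; apply: leq_trans (max_card _) H2.
apply: (@isomorphic_star_le2 _ x') => // -[y yC] yx.
have {}yx : y != x by apply: contraNneq yx => e; apply/eqP/val_inj.
change (@adj H x y).
move: yC; rewrite inE => /connectP[[|z p] /=].
  by move=> _ e; rewrite e eqxx in yx.
case/andP; rewrite -[X in is_true X]/(@adj H x z) => xz _ _.
have zx : z != x.
  by apply: contraTneq xz => ->; rewrite adj_irrefl.
suff -> : y = z by exact: xz.
apply/eqP/negPn/negP => yz.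
have : #|[set x; y; z]| <= 2 by apply: leq_trans (max_card _) H2.
by rewrite -setUA !cardsU1 cards1 !inE negb_or eq_sym yx eq_sym zx yz.
Qed.

Lemma star_colorable_exists (G : sgraph) : exists k, `[< star_colorable G k >].
Proof. by exists #|G|; apply/asboolP/star_colorable_card. Qed.

Definition star_chromatic_number (G : sgraph) : nat :=
  ex_minn (star_colorable_exists G).

Definition clique (G : sgraph) (K : {set G}) : bool :=
  [forall x in K, forall y in K, (x != y) ==> adj x y].

Definition clique_number (G : sgraph) : nat :=
  \max_(K : {set G} | clique K) #|K|.

Definition hereditary (C : sgraph -> Prop) : Prop :=
  forall G H : sgraph, induced_subgraph G H -> C H -> C G.

Local Open Scope ring_scope.

Definition polynomially_bounded (R : realType) (f : nat -> R) : Prop :=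
  exists p : {poly R}, forall n : nat, f n <= p.[n%:R].

Definition polynomially_chi_s_bounded (R : realType) (C : sgraph -> Prop) :
    Prop :=
  hereditary C /\
  exists2 f : nat -> R, polynomially_bounded f &
    forall G : sgraph, C G -> (star_chromatic_number G)%:R <= f (clique_number G).

(* Main.v *)
(** A vertex neighbourhood of a K_{1,t}-free graph has no stable set of size t
    and no clique larger than w, so the maximum degree is at most
    D = t w^(t-1).  For graphs of maximum degree at most D we have
    chi_s = O(D^(3/2)), by Rosenfeld's counting argument instead of the local
    lemma: with b >= D^(3/2) and D + 3b colors, each new vertex v multiplies
    the number of star colorings by at least b.  Indeed at most D
    |C(S)| of the extensions of the set C(S) of star colorings of S are
    improper, and when v closes a bicolored path on four vertices, the colors
    of v and of one more vertex x of that path are determined by the rest;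
    there are at most 2 D^3 such paths, and each accounts for at most
    |C(S \ x)| <= |C(S)| / b extensions. *)

Require Import Defs.
From mathcomp Require Import all_boot all_order all_algebra.
From mathcomp Require Import boolp reals exp.
From mathcomp Require Import zify.

Set Implicit Arguments.
Unset Strict Implicit.
Unset Printing Implicit Defensive.

Import Order.TTheory GRing.Theory Num.Theory.

(** * Star forests and bicolored paths on four vertices *)

Lemma isomorphic_star (G : sgraph) (z : G) :
  (forall y, y != z -> adj z y) ->
  (forall u w, adj z u -> adj u w -> w = z) ->
  exists n, isomorphic G (star n).
Proof.
move=> adjz nadj; pose T : finType := {y : G | y != z}; exists #|T|.
pose f (y : G) : star #|T| := omap enum_rank (insub y : option T).
pose g (o : star #|T|) : G := if o is Some i then val (enum_val i) else z.
have fK : cancel f g.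
  by move=> y; rewrite /f; case: insubP => [u _ <-|/negPn/eqP ->] //=; rewrite enum_rankK.
have gK : cancel g f.
  case=> [i|]; rewrite /f /=; first by rewrite valK /= enum_valK.
  by rewrite insubF // eqxx.
have fE y : isSome (f y) = (y != z).
  by rewrite /f; case: insubP => [u ->|/negbTE ->].
exists f; first by exists g.
split=> [|y w]; first exact: can_inj fK.
transitivity (isSome (f y) != isSome (f w)); [by [] | rewrite !fE].
case: (eqVneq y z) => [->|yz]; case: (eqVneq w z) => [->|wz] /=.
- by rewrite adj_irrefl.
- by rewrite adjz.
- by rewrite adj_sym adjz.
- by apply/esym/negP => yw; move: wz; rewrite (nadj y w) ?eqxx ?adjz.
Qed.

(** A walk from [z] is back at [z] after every second step, so the component consists of [z] and its
    neighbours, and the latter are pairwise non-adjacent. *)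
Lemma star_forest_center (G : sgraph) :
  (forall x : G, exists2 z, connect adj x z &
    forall u w, adj z u -> adj u w -> w = z) -> star_forest G.
Proof.
move=> center x; have [z xz zc] := center x.
have zC : z \in component x by rewrite inE.
pose z' : induced (component x) := exist _ z zC.
apply: (@isomorphic_star _ z') => [[y yC] yz|[u uC] [w wC] zu uw].
  change (@adj G z y).
  have {}yz : y != z by apply: contraNneq yz => e; apply/eqP/val_inj.
  have /connectP[p] : connect adj z y.
    rewrite (connect_trans _ (_ : connect adj x y)) //; last by rewrite inE in yC.
    by rewrite (sym_connect_sym (@adj_sym G)).
  elim/last_ind: p y {yC} yz => [|p u IHp] y yz /=; first by move=> _ e; rewrite e eqxx in yz.
  rewrite rcons_path last_rcons => /andP[pp lu] e.
  have [lz|lz] := eqVneq (last z p) z; first by rewrite e; rewrite lz in lu.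
  have zl := IHp _ lz pp erefl.
  by rewrite e (zc _ _ zl lu) eqxx in yz.
exact/val_inj/(zc u w).
Qed.

(** A path on four vertices as a subgraph; chords are allowed. *)
Definition p4 (G : sgraph) (a b c d : G) : bool :=
  [&& adj a b, adj b c, adj c d & uniq [:: a; b; c; d]].

Lemma p4_sym (G : sgraph) (a b c d : G) : p4 a b c d = p4 d c b a.
Proof.
rewrite /p4 (adj_sym d c) (adj_sym c b) (adj_sym b a) -(rev_uniq [:: d; _; _; _]).
by case: (adj a b); case: (adj b c); case: (adj c d).
Qed.

(** Two color classes span a graph with no triangle and no path on four vertices, so every component
    has a centre: [x] itself if it is isolated or has two neighbours, otherwise its only
    neighbour. *)
Lemma star_coloringP4 (G : sgraph) (k : nat) (f : G -> 'I_k) :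
  proper_coloring f ->
  (forall a b c d, p4 a b c d -> f a = f c -> f b <> f d) ->
  star_coloring f.
Proof.
move=> fP f4; split=> // i j ij; set S := [set x | _]; set H := induced S.
have twocol (x y z : H) : adj x y -> adj x z -> f (val y) = f (val z).
  case: x y z => x xS [y yS] [z zS] /fP /= xy /fP /= xz.
  rewrite !inE in xS yS zS.
  move: xy xz; case/orP: xS => /eqP ->; case/orP: yS => /eqP ->;
    by case/orP: zS => /eqP ->; rewrite ?eqxx.
have noP4 (a b c d : H) : adj a b -> adj b c -> adj c d -> uniq [:: a; b; c; d] -> False.
  move=> ab bc cd u; apply: (f4 (val a) (val b) (val c) (val d)).
  - exact/and4P.
  - by apply: twocol bc; rewrite adj_sym.
  - by apply: twocol cd; rewrite adj_sym.
have tri (a b c : H) : adj a b -> adj b c -> adj c a -> False.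
  move=> ab bc ca; have := fP _ _ (bc : @adj G (val b) (val c)).
  by rewrite (twocol a b c) ?eqxx // adj_sym.
have neq (a b : H) : adj a b -> a != b.
  by apply: contraTneq => ->; rewrite adj_irrefl.
apply: star_forest_center => x.
have [[y xy]|x0] := pselect (exists y, adj x y); last first.
  by exists x => [|u w xu]; [exact: connect0 | case: x0; exists u].
have [[y' xy' yy']|one] := pselect (exists2 y', adj x y' & y' != y).
  exists x => [|u w xu uw]; first exact: connect0.
  have [v xv vu] : exists2 v, adj x v & v != u.
    by have [->|yu] := eqVneq u y; [exists y' | exists y; rewrite // eq_sym].
  (* A second neighbour [v] of [x] would extend [x], [u], [w] to a path; [v = w] would give a
     triangle. *)
  apply/eqP/negPn/negP => wx; apply: (noP4 v x u w) => //; first by rewrite adj_sym.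
  have vw : v != w.
    apply/eqP => e; apply: (tri x u w) => //.
    by rewrite -e adj_sym.
  by rewrite /= !inE !negb_or vu vw (eq_sym x w) wx !neq // adj_sym.
exists y => [|u w yu uw]; first exact: connect1.
have [ux|ux] := eqVneq u x.
  by apply/eqP/negPn/negP => wy; apply: one; exists w; rewrite -?ux.
apply/eqP/negPn/negP => wy; apply: (noP4 x y u w) => //.
have xw : x != w.
  by apply/eqP => e; apply: (tri x y u) => //; rewrite e.
by rewrite /= !inE !negb_or (eq_sym x u) ux xw (eq_sym y w) wy !neq.
Qed.

(** * Counting partial star colorings and their extensions *)

Section Counting.
Variables (G : sgraph) (k : nat) (c0 : 'I_k).
Implicit Types (S : {set G}) (f g : {ffun G -> 'I_k}).

(* Colors outside S are frozen to c0, so that partials S is in bijection with the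
   star colorings of the subgraph induced by S. *)
Definition partial_star_coloring S f : Prop :=
  [/\ forall x, x \notin S -> f x = c0,
      forall x y, x \in S -> y \in S -> adj x y -> f x != f y &
      forall a b c d, {subset [:: a; b; c; d] <= S} -> p4 a b c d ->
        f a = f c -> f b <> f d].

Definition partials S : {set {ffun G -> 'I_k}} :=
  [set f | `[< partial_star_coloring S f >]].

Definition recolor (v : G) (i : 'I_k) f : {ffun G -> 'I_k} :=
  [ffun x => if x == v then i else f x].

(** For [v] outside [S]: star colorings of [S] with any color at [v], conflicting or not. *)
Definition extensions (v : G) S : {set {ffun G -> 'I_k}} :=
  [set f | recolor v c0 f \in partials S].

(** Recoloring [v] is injective in the pair of color and coloring, because all members of
    [partials S] agree at [v]. *)
Lemma card_extensions v S : v \notin S ->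
  k * #|partials S| <= #|extensions v S|.
Proof.
move=> vS; rewrite -[k in k * _]card_ord -cardsT -cardsX.
pose h (p : 'I_k * {ffun G -> 'I_k}) := recolor v p.1 p.2.
rewrite -(@card_in_imset _ _ h (setX setT (partials S))).
  apply/subset_leq_card/subsetP => y /imsetP[[i f]]; rewrite !inE /= => fS ->.
  rewrite (_ : recolor v c0 _ = f) //.
  apply/ffunP => x; rewrite !ffunE; case: eqVneq => // ->.
  by case/asboolP: fS => /(_ v vS).
move=> [i f] [j g]; rewrite !inE /= => /asboolP[f0 _ _] /asboolP[g0 _ _] e.
have E x : (if x == v then i else f x) = (if x == v then j else g x).
  by have /ffunP/(_ x) := e; rewrite !ffunE.
congr pair; first by have := E v; rewrite eqxx.
by apply/ffunP => x; have := E x; case: eqVneq => // ->; rewrite f0 // g0.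
Qed.

Lemma recolor_partials x S f :
  f \in partials S -> recolor x c0 f \in partials (S :\ x).
Proof.
rewrite !inE => /asboolP[f0 f1 f2]; apply/asboolP.
have fE y : y \in S :\ x -> (y \in S) * (recolor x c0 f y = f y).
  by rewrite !inE ffunE => /andP[/negbTE -> ->].
split=> [y|y z /fE[yS ->] /fE[zS ->]|a b c d sub].
- rewrite !inE ffunE negb_and negbK; case: eqVneq => //= _; exact: f0.
- exact: f1.
have sE y : y \in [:: a; b; c; d] -> recolor x c0 f y = f y.
  by move/sub/fE => [].
rewrite !sE ?inE ?eqxx ?orbT //; apply: f2 => y /sub; by rewrite inE => /andP[].
Qed.

(** The color of [v] can be read off at [u], so erasing it loses nothing. *)
Lemma card_edge_extensions v u S : v != u ->
  #|[set g in extensions v S | g v == g u]| <= #|partials S|.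
Proof.
move=> vu; set A := [set g in _ | _].
rewrite -(@card_in_imset _ _ (recolor v c0) A).
  by apply/subset_leq_card/subsetP => _ /imsetP[f fE ->]; move: fE; rewrite !inE => /andP[].
move=> f g; rewrite !inE => /andP[_ /eqP fv] /andP[_ /eqP gv] /ffunP e.
have E x : x != v -> f x = g x by move=> xv; have := e x; rewrite !ffunE (negbTE xv).
by apply/ffunP => x; have [->|/E//] := eqVneq x v; rewrite fv gv E // eq_sym.
Qed.

(** The erased colors of [v] and [x] are recovered from [a] and [b], which keep theirs. *)
Lemma card_path_extensions v x a b S : uniq [:: v; x; a; b] ->
  #|[set g in extensions v S | (g v == g a) && (g x == g b)]|
    <= #|partials (S :\ x)|.
Proof.
rewrite /= !inE !negb_or => /and4P[/and3P[vx va vb] /andP[xa xb] _ _].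
set A := [set g in _ | _].
rewrite -(@card_in_imset _ _ (recolor x c0 \o recolor v c0) A).
  apply/subset_leq_card/subsetP => _ /imsetP[f fE ->]; move: fE.
  by rewrite [in X in X -> _]inE => /andP[+ _]; rewrite inE; apply: recolor_partials.
move=> f g; rewrite !inE => /and3P[_ /eqP fv /eqP fx] /and3P[_ /eqP gv /eqP gx] /ffunP e.
have E y : y != v -> y != x -> f y = g y.
  by move=> /negbTE yv /negbTE yx; have := e y; rewrite !ffunE /= yv yx.
apply/ffunP => y; have [->|yv] := eqVneq y v; first by rewrite fv gv E // eq_sym.
have [->|/E->//] := eqVneq y x; by rewrite fx gx E // eq_sym.
Qed.

End Counting.

(** * Bad extensions and the growth inequality *)

Lemma card_bigcup_leq_sum (I T : finType) (P : pred I) (F : I -> {set T}) :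
  #|\bigcup_(i | P i) F i| <= \sum_(i | P i) #|F i|.
Proof.
elim/big_rec2: _ => [|i n A _ An]; first by rewrite cards0.
by rewrite (leq_trans (leq_card_setU _ _)) // leq_add2l.
Qed.

(** Union bound over a neighbourhood, to be nested along a path. The factor [b] on the left replaces
    a division by [b]. *)
Lemma card_bigcup_adj (G : sgraph) (T : finType) (F : G -> {set T}) (v : G)
    (D b m : nat) :
  #|[set u | adj v u]| <= D -> (forall u, adj v u -> b * #|F u| <= m) ->
  b * #|\bigcup_(u | adj v u) F u| <= D * m.
Proof.
move=> dD Fm; apply: leq_trans (leq_mul dD (leqnn m)).
have /(leq_mul (leqnn b)) := card_bigcup_leq_sum (adj v) F.
move=> /leq_trans; apply; rewrite big_distrr /= -sum_nat_const.
by rewrite [leqRHS](eq_bigl (adj v)) => [|u]; [exact: leq_sum | rewrite inE].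
Qed.

(** A new conflict must involve [v]: an edge at [v], or a bicolored path which, up to reversal, has
    [v] as first or second vertex. The path's other first or last vertex is recorded as lying in
    [S], so that it can later be removed from [S]. *)
Lemma extensionsP (G : sgraph) k (c0 : 'I_k) v (S : {set G}) : v \notin S ->
  extensions c0 v S \subset
    partials c0 (v |: S)
    :|: \bigcup_(u | adj v u) [set g in extensions c0 v S | g v == g u]
    :|: (\bigcup_(b | adj v b) \bigcup_(c | adj b c) \bigcup_(d | adj c d)
          [set g in extensions c0 v S |
            [&& p4 v b c d, d \in S, g v == g c & g d == g b]]
    :|: \bigcup_(c | adj v c) \bigcup_(d | adj c d) \bigcup_(a | adj v a)
          [set g in extensions c0 v S |
            [&& p4 a v c d, a \in S, g v == g d & g a == g c]]).
Proof.
move=> vS; apply/subsetP => g gE; rewrite !in_setU; apply: contraT.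
rewrite !negb_or => /andP[/andP[noA noU1] /andP[noU2 noU3]].
suff gA : g \in partials c0 (v |: S) by rewrite gA in noA.
have noedge u : adj v u -> g v != g u.
  by move=> vu; apply: contra noU1 => gu; apply/bigcupP; exists u; rewrite // inE gE.
have noend b c d : p4 v b c d -> d \in S -> g v = g c -> g b <> g d.
  move=> p dS gv gb; have /and4P[vb bc cd _] := p; apply: (negP noU2).
  apply/bigcupP; exists b => //; apply/bigcupP; exists c => //.
  by apply/bigcupP; exists d => //; rewrite inE gE p dS gv gb !eqxx.
have nomid a c d : p4 a v c d -> a \in S -> g a = g c -> g v <> g d.
  move=> p aS ga gv; have /and4P[av vc cd _] := p; apply: (negP noU3).
  apply/bigcupP; exists c => //; apply/bigcupP; exists d => //.
  by apply/bigcupP; exists a; [rewrite adj_sym | rewrite inE gE p aS ga gv !eqxx].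
move: gE; rewrite inE inE => /asboolP[g0 g1 g2]; rewrite inE; apply/asboolP.
have gN x : x != v -> recolor v c0 g x = g x by rewrite ffunE => /negbTE ->.
have inS x : x \in v |: S -> x != v -> x \in S by rewrite !inE => /orP[->|].
split=> [x|x y xS yS xy|a b c d sub p ac bd].
- by rewrite !inE negb_or => /andP[xv xS]; rewrite -gN // g0.
- have [xv|xv] := eqVneq x v; first by rewrite xv noedge -?xv.
  have [yv|yv] := eqVneq y v; first by rewrite yv eq_sym noedge // -yv adj_sym.
  by rewrite -(gN x) // -(gN y) // g1 ?inS.
have [aS bS cS dS] : [/\ a \in v |: S, b \in v |: S, c \in v |: S & d \in v |: S].
  by split; apply: sub; rewrite !inE eqxx ?orbT.
have /and4P[_ _ _] := p; rewrite /= !inE !negb_or !andbT.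
case/and3P=> /and3P[ab ac' ad] /andP[bc bd'] cd.
have [av|av] := eqVneq a v.
  by subst a; apply: noend p _ ac bd; apply: inS; rewrite // eq_sym.
have [dv|dv] := eqVneq d v.
  by subst d; move: p; rewrite p4_sym => p; apply: noend p _ _ _; rewrite ?inS.
have [bv|bv] := eqVneq b v.
  by subst b; apply: nomid p _ ac bd; apply: inS.
have [cv|cv] := eqVneq c v.
  by subst c; move: p; rewrite p4_sym => p; apply: nomid p _ _ _; rewrite ?inS.
apply: (g2 a b c d) => //; rewrite ?gN // => x.
by rewrite !inE => /or4P[] /eqP ->; rewrite inS.
Qed.

Section StarColorable.
Variables (G : sgraph) (D b : nat).
Hypothesis degD : forall v : G, #|[set u | adj v u]| <= D.
Hypothesis b_gt0 : 0 < b.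
Hypothesis D3b2 : D ^ 3 <= b ^ 2.

Lemma partials_growth (c0 : 'I_(D + 3 * b)) (S : {set G}) (v : G) : v \in S ->
  b * #|partials c0 (S :\ v)| <= #|partials c0 S|.
Proof.
have [n] := ubnP #|S|; elim: n S v => // n IHn S v Sn vS.
set S' := S :\ v; set m := #|partials c0 S'|.
have vS' : v \notin S' by rewrite !inE eqxx.
have IH x : x \in S' -> b * #|partials c0 (S' :\ x)| <= m.
  move=> xS; apply: IHn => //; rewrite (cardsD1 v S) vS in Sn; exact: Sn.
have := subset_leq_card (extensionsP c0 vS'); rewrite setD1K //.
set E := extensions _ _ _; set C := #|partials c0 S|.
set U1 := \bigcup_(_ | _) _; set U2 := \bigcup_(_ | _) _; set U3 := \bigcup_(_ | _) _.
have E1 : b * #|U1| <= D * (b * m).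
  apply: card_bigcup_adj => // u vu; rewrite leq_mul2l card_edge_extensions ?orbT //.
  by apply: contraTneq vu => ->; rewrite adj_irrefl.
(* Bound for triples that give no path or whose vertex to be removed lies outside [S']. *)
have U0 : b * #|@set0 {ffun G -> 'I_(D + 3 * b)}| <= m by rewrite cards0 muln0.
have E2 : b * #|U2| <= D * (D * (D * m)).
  apply: card_bigcup_adj => // x vx; apply: card_bigcup_adj => // y xy.
  apply: card_bigcup_adj => // z yz.
  have [/andP[p zS]|no] := boolP (p4 v x y z && (z \in S')); last first.
    rewrite (_ : [set _ in _ | _] = set0) //; apply/setP => g; rewrite in_set0 inE.
    by apply: contraNF no => /andP[_ /and4P[-> -> _ _]].
  apply: leq_trans (IH z zS); rewrite leq_mul2l.
  (* On the path [v], [x], [y], [z] the color of [v] is that of [y], and the color of [z] is that of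
     [x]. *)
  rewrite (leq_trans _ (@card_path_extensions _ _ c0 v z y x S' _)) ?orbT //.
    by apply/subset_leq_card/subsetP => g; rewrite inE => /andP[gE /and4P[_ _ gv gz]]; rewrite inE gE gv.
  case/and4P: p => _ _ _; rewrite /= !inE !negb_or !andbT.
  by rewrite (eq_sym z y) (eq_sym z x) (eq_sym y x); do !case: (_ == _).
have E3 : b * #|U3| <= D * (D * (D * m)).
  apply: card_bigcup_adj => // y vy; apply: card_bigcup_adj => // z yz.
  apply: card_bigcup_adj => // x vx.
  have [/andP[p xS]|no] := boolP (p4 x v y z && (x \in S')); last first.
    rewrite (_ : [set _ in _ | _] = set0) //; apply/setP => g; rewrite in_set0 inE.
    by apply: contraNF no => /andP[_ /and4P[-> -> _ _]].
  apply: leq_trans (IH x xS); rewrite leq_mul2l.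
  (* On the path [x], [v], [y], [z] the color of [v] is that of [z], and the color of [x] is that of
     [y]. *)
  rewrite (leq_trans _ (@card_path_extensions _ _ c0 v x z y S' _)) ?orbT //.
    by apply/subset_leq_card/subsetP => g; rewrite inE => /andP[gE /and4P[_ _ gv gz]]; rewrite inE gE gv.
  case/and4P: p => _ _ _; rewrite /= !inE !negb_or !andbT.
  by rewrite (eq_sym v x) (eq_sym z y); do !case: (_ == _).
have Em := card_extensions c0 vS'; rewrite -/E -/m in Em.
move=> le_E.
have {}le_E : #|E| <= C + #|U1| + (#|U2| + #|U3|).
  apply: leq_trans le_E _; apply: leq_trans (leq_card_setU _ _) _.
  by apply: leq_add; apply: leq_card_setU.
(* After multiplication by [b]: [b(D + 3b)m <= bC + Dbm + 2D^3 m], and [D^3 <= b^2] leaves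
   [b^2 m <= bC]. *)
rewrite -(leq_pmul2l b_gt0).
have := leq_mul D3b2 (leqnn m); rewrite !expnS expn0 !muln1 => D3.
have := leq_mul (leqnn b) (leq_trans Em le_E).
clear -E1 E2 E3 D3.
lia.
Qed.

Lemma partials_gt0 (c0 : 'I_(D + 3 * b)) (S : {set G}) : 0 < #|partials c0 S|.
Proof.
have [n] := ubnP #|S|; elim: n S => // n IHn S Sn.
have [->|[v vS]] := set_0Vmem S.
  apply/card_gt0P; exists [ffun=> c0]; rewrite inE; apply/asboolP.
  split=> [x _|x y|a b' c d /(_ a (mem_head _ _))]; by rewrite ?ffunE // inE.
apply: leq_trans (partials_growth c0 vS); rewrite muln_gt0 b_gt0 IHn //.
by rewrite (cardsD1 v S) vS in Sn.
Qed.

Lemma star_colorable_maxdeg : star_colorable G (D + 3 * b).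
Proof.
have k_gt0 : 0 < D + 3 * b by lia.
have /card_gt0P[f] := partials_gt0 (Ordinal k_gt0) [set: G].
rewrite inE => /asboolP[_ f1 f2]; exists f; apply: star_coloringP4.
  by move=> x y; apply: f1; rewrite inE.
by move=> a b' c d; apply: f2 => x _; rewrite inE.
Qed.

End StarColorable.

(** * Cliques, stable sets and the degree of star-free graphs *)

Definition stable (G : sgraph) (I : {set G}) : bool :=
  [forall x in I, forall y in I, ~~ adj x y].

Lemma stableP (G : sgraph) (I : {set G}) :
  reflect {in I &, forall x y, ~~ adj x y} (stable I).
Proof.
apply: (iffP forall_inP) => [H x y /H/forall_inP|H x xI]; first exact.
by apply/forall_inP => y; apply: H.
Qed.

Lemma cliqueP (G : sgraph) (K : {set G}) :
  reflect {in K &, forall x y, x != y -> adj x y} (clique K).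
Proof.
apply: (iffP forall_inP) => [H x y /H/forall_inP h /h/implyP//|H x xK].
by apply/forall_inP => y yK; apply/implyP; apply: H.
Qed.

(* Every vertex of A outside a maximum clique K of A is a non-neighbour of some
   x in K, and adding x to a stable set of non-neighbours of x keeps it stable. *)
Lemma card_le_clique_stable (G : sgraph) (w s : nat) (A : {set G}) :
  (forall K : {set G}, K \subset A -> clique K -> #|K| <= w) ->
  (forall I : {set G}, I \subset A -> stable I -> #|I| <= s) ->
  #|A| <= s * w ^ s.
Proof.
elim: s A => [|s IHs] A Aw As.
  rewrite mul0n leqn0 cards_eq0; apply/set0Pn => -[x xA].
  have st : stable [set x] by apply/stableP => y z /set1P -> /set1P ->; rewrite adj_irrefl.
  by have := As [set x]; rewrite sub1set cards1 => /(_ xA st).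
have K0 : (set0 \subset A) && clique (set0 : {set G}).
  by rewrite sub0set; apply/cliqueP => x y; rewrite inE.
case: (@arg_maxnP _ set0 (fun K : {set G} => (K \subset A) && clique K) (fun K => #|K|) K0).
move=> K /andP[KA Kcl] Kmax.
pose N x := [set y in A | ~~ adj x y && (y != x)].
have cardN x : x \in A -> #|N x| <= s * w ^ s.
  have NA : N x \subset A by apply/subsetP => y; rewrite inE => /andP[].
  move=> xA; apply: IHs => [L LN|I IN /stableP stI]; first by apply: Aw; apply: subset_trans NA.
  have IE y : y \in I -> [&& y \in A, ~~ adj x y & y != x].
    by move/(subsetP IN); rewrite inE.
  have xI : x \notin I by apply/negP => /IE; rewrite eqxx !andbF.
  suff : #|x |: I| <= s.+1 by rewrite cardsU1 xI.
  apply: As; first by rewrite subUset sub1set xA (subset_trans IN).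
  apply/stableP => y z; rewrite !inE => /predU1P[->|yI] /predU1P[->|zI].
  - by rewrite adj_irrefl.
  - by case/IE/and3P: zI.
  - by rewrite adj_sym; case/IE/and3P: yI.
  - exact: stI.
have cover : A \subset K :|: \bigcup_(x in K) N x.
  apply/subsetP => y yA; rewrite inE; have [//|yK /=] := boolP (y \in K).
  apply: contraT => noN; suff /Kmax : (y |: K \subset A) && clique (y |: K).
    by rewrite /= cardsU1 yK add1n ltnn.
  rewrite subUset sub1set yA KA /=; apply/cliqueP.
  have adjy x : x \in K -> adj x y.
    move=> xK; apply: contraR noN => xy; apply/bigcupP; exists x => //.
    by rewrite inE yA xy /=; apply: contraNneq yK => ->.
  move=> u v; rewrite !inE => /predU1P[->|uK] /predU1P[->|vK]; rewrite ?eqxx // => uv.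
  - by rewrite adj_sym adjy.
  - exact: adjy.
  - exact: (cliqueP _ Kcl).
have Kw : #|K| <= w by apply: Aw.
apply: leq_trans (subset_leq_card cover) _.
apply: leq_trans (leq_card_setU _ _) _.
have sumN : #|\bigcup_(x in K) N x| <= \sum_(x in K) s * w ^ s.
  apply: leq_trans (card_bigcup_leq_sum _ _) _.
  by apply: leq_sum => x xK; apply/cardN/(subsetP KA).
(* [K] accounts for one [w^(s+1)], and the sets [N x] for at most [w] times [s w^s]. *)
rewrite sum_nat_const in sumN; rewrite mulSn leq_add //.
  apply: leq_trans Kw _; rewrite expnS; case: (w) => // n.
  by rewrite leq_pmulr // expn_gt0.
by apply: leq_trans sumN _; rewrite expnS [leqRHS]mulnCA leq_mul2r Kw orbT.
Qed.

Lemma clique_leq_number (G : sgraph) (K : {set G}) :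
  clique K -> #|K| <= clique_number G.
Proof. exact: (leq_bigmax_cond (F := fun K : {set G} => #|K|)). Qed.

Lemma clique_number_gt0 (G : sgraph) : 0 < #|G| -> 0 < clique_number G.
Proof.
case/card_gt0P => x _; rewrite -(cards1 x); apply: clique_leq_number.
by apply/cliqueP => y z /set1P -> /set1P ->; rewrite eqxx.
Qed.

(** Any [t] vertices of [I] would be the leaves of an induced star centred at [v]. *)
Lemma star_free_stable_nbr (G : sgraph) (t : nat) (v : G) (I : {set G}) :
  star_free t G -> I \subset [set u | adj v u] -> stable I -> #|I| < t.
Proof.
move=> tfree Iv /stableP stI; rewrite ltnNge; apply/negP => tI; apply: tfree.
pose h (i : 'I_t) : G := enum_val (widen_ord tI i).
have hI i : h i \in I by apply: enum_valP.
have vh i : adj v (h i) by have := subsetP Iv _ (hI i); rewrite inE.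
exists (fun o : star t => if o is Some i then h i else v); split.
  case=> [i|] [j|] //= e.
  - by move/enum_val_inj: e => /(congr1 val) /= ij; congr Some; apply: val_inj.
  - by have := vh i; rewrite e adj_irrefl.
  - by have := vh j; rewrite -e adj_irrefl.
case=> [i|] [j|] /=.
- exact/negbTE/stI.
- by rewrite adj_sym vh.
- by rewrite vh.
- by rewrite adj_irrefl.
Qed.

Lemma star_free_degree (G : sgraph) (t : nat) (v : G) :
  star_free t G -> #|[set u | adj v u]| <= t.-1 * clique_number G ^ t.-1.
Proof.
move=> tfree; apply: card_le_clique_stable => [K _|I Iv stI].
  exact: clique_leq_number.
by have := star_free_stable_nbr tfree Iv stI; case: (t).
Qed.

(** * Numerical bounds on the star chromatic number *)

Lemma sqrt_approx (n : nat) : exists2 b, n <= b ^ 2 & b ^ 2 <= 4 * n.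
Proof.
have ex : exists b, n <= b ^ 2 by exists n; rewrite -mulnn; nia.
case: (ex_minnP ex) => b nb bmin; exists b => //.
case: b nb bmin => [|b] nb bmin; first by rewrite exp0n.
have : ~~ (n <= b ^ 2) by apply/negP => /bmin; rewrite ltnn.
move: nb; rewrite -!mulnn; clear; case: b => [|b]; nia.
Qed.

Lemma star_chromatic_number_min (G : sgraph) (k : nat) :
  star_colorable G k -> star_chromatic_number G <= k.
Proof.
move=> Gk; rewrite /star_chromatic_number; case: ex_minnP => m _; apply.
exact/asboolP.
Qed.

(** With [b] about [D^(3/2)], and [D <= b] because [D] is positive, [D + 3b <= 4b] colors suffice,
    and [16 b^2 <= 64 D^3]. Squaring avoids half-integer exponents. *)
Lemma star_chromatic_number_maxdeg (G : sgraph) (D : nat) :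
  0 < D -> (forall v : G, #|[set u | adj v u]| <= D) ->
  star_chromatic_number G ^ 2 <= 64 * D ^ 3.
Proof.
move=> D0 degD; have [b D3b b4] := sqrt_approx (D ^ 3).
have Db : D <= b by rewrite -leq_sqr (leq_trans _ D3b) // leq_pexp2l.
have b0 : 0 < b by apply: leq_trans Db.
have le4b : star_chromatic_number G <= 4 * b.
  apply: leq_trans (star_chromatic_number_min (star_colorable_maxdeg degD b0 D3b)) _.
  by rewrite (mulnDl 1 3) mul1n leq_add2r.
rewrite (leq_trans (_ : _ <= (4 * b) ^ 2)) ?leq_sqr // expnMn.
by rewrite -[64]/(16 * 4) -mulnA leq_mul2l.
Qed.

Lemma star_chromatic_number_star_free (G : sgraph) (t : nat) :
  0 < t -> 0 < #|G| -> star_free t G ->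
  star_chromatic_number G ^ 2 <= 64 * t ^ 3 * clique_number G ^ (3 * t.-1).
Proof.
move=> t0 G0 tfree; rewrite mulnC (mulnC 3) expnM mulnA -mulnA.
(* [D = t w^(t-1)]; the factor [t] instead of [t - 1] keeps [D] positive for [t = 1]. *)
rewrite (mulnC (_ ^ 3)) -mulnA -expnMn; apply: star_chromatic_number_maxdeg.
  by rewrite muln_gt0 t0 expn_gt0 clique_number_gt0.
move=> v; apply: leq_trans (star_free_degree v tfree) _.
by rewrite leq_mul2r leq_pred orbT.
Qed.

Lemma hereditary_star_free (t : nat) : hereditary (star_free t).
Proof.
move=> G H [f [f_inj f_adj]] Hfree [g [g_inj g_adj]]; apply: Hfree.
exists (f \o g); split=> [|x y]; first exact: inj_comp.
by rewrite /= f_adj g_adj.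
Qed.

Local Open Scope ring_scope.

Theorem theorem4 (R : realType) (t : nat) (t_gt0 : (0 < t)%N) :
  polynomially_chi_s_bounded R (star_free t) /\
  exists c : R, forall G : sgraph, (0 < #|G|)%N -> star_free t G ->
    (star_chromatic_number G)%:R
      <= c * (clique_number G)%:R `^ (3 * (t%:R - 1) / 2).
Proof.
split; [split; first exact: hereditary_star_free|].
  (* The bound on the square serves as [f], since a natural number is at most its square. *)
  pose f n : R := (64 * t ^ 3 * n ^ (3 * t.-1))%:R.
  exists f.
    exists ((64 * t ^ 3)%:R *: 'X^(3 * t.-1)) => n.
    by rewrite hornerZ hornerXn -natrX -natrM.
  move=> G tfree; rewrite /f ler_nat; case: (posnP #|G|) => [G0|G0].
    by rewrite (leq_trans (star_chromatic_number_min (star_colorable_card G))) // G0.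
  apply: leq_trans (star_chromatic_number_star_free t_gt0 G0 tfree).
  by case: star_chromatic_number => // n; rewrite -mulnn leq_pmulr.
(* Both sides are compared after squaring; [(8 t^2)^2 = 64 t^4] dominates [64 t^3]. *)
exists (8 * t%:R ^+ 2) => G G0 tfree.
set w := clique_number G.
have e2 : (w%:R `^ (3 * (t%:R - 1) / 2)) ^+ 2 = (w ^ (3 * t.-1))%:R :> R.
  rewrite -powR_mulrn ?powR_ge0 // -powRrM divfK ?pnatr_eq0 //.
  have -> : 3 * (t%:R - 1) = (3 * t.-1)%:R :> R.
    by rewrite natrM -subn1 natrB.
  by rewrite powR_mulrn ?ler0n // natrX.
have c_ge0 : 0 <= 8 * t%:R ^+ 2 :> R by rewrite mulr_ge0 ?exprn_ge0 ?ler0n.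
rewrite -(@ler_pXn2r _ 2) ?nnegrE ?mulr_ge0 ?powR_ge0 ?ler0n //.
rewrite exprMn e2 exprMn -!natrX -!natrM ler_nat.
apply: leq_trans (star_chromatic_number_star_free t_gt0 G0 tfree) _.
by rewrite leq_mul // -expnM leq_mul // leq_pexp2l.
Qed.
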